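(* The Chazy IX equation $$u'''=54u^4+72u^2u'+12(u')^2+\delta\qquad(\delta\in\mathbb{C})$$ is invariant under the birational transformation $g_1:(u;\delta)\mapsto(p;\tilde\delta)$ given by $$p=\frac{(-\sqrt5-3)\left\{108u^4+18(5-\sqrt5)u^2u'+6(3-\sqrt5)(u')^2+3(-\sqrt5-1)uu''+2\delta\right\}}{6(-\sqrt5-1)\left\{3(-\sqrt5-1)uu'+u''\right\}},\qquad \tilde\delta=\frac{7-3\sqrt5}{2}\,\delta .$$
   Context: Primes denote derivatives with respect to the complex variable $t$. Invariance means: if $u$ is a solution of the equation with parameter $\delta$, then, wherever the denominator is nonzero, $p$ is a solution of the same equation with $\delta$ replaced by $\tilde\delta$, i.e. $p'''=54p^4+72p^2p'+12(p')^2+\tilde\delta$. Birational means that the induced map $(u,u',u'')\mapsto(p,p',p'')$, with $p',p''$ expressed in terms of $u,u',u''$ by means of the equation for $u$, is a birational map. *)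

(* Defs.v *)
From HB Require Import structures.
From mathcomp Require Import all_boot all_order all_algebra fraction complex.
From mathcomp Require Import classical_sets reals topology normedtype derive.
(* The notations of mpoly clash with those of the analysis files. *)
From mathcomp Require Import -(notations) mpoly.

Set Implicit Arguments.
Unset Strict Implicit.
Unset Printing Implicit Defensive.

Import Order.TTheory GRing.Theory Num.Theory.
Import numFieldNormedType.Exports.
Local Open Scope ring_scope.
Local Open Scope classical_set_scope.

(* Used both with complex numbers and with polynomials in the coordinates of
   the jet (u, u', u''). *)
Definition chazyIX_rhs (A : pzRingType) (delta u u' : A) : A :=
  54 * u ^+ 4 + 72 * u ^+ 2 * u' + 12 * u' ^+ 2 + delta.

Definition chazyIX_solution (C : numFieldType) (delta : C)
    (D : set C) (u : C -> C) : Prop :=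
  [/\ open D,
      forall t, D t -> forall k, (k < 3)%N -> derivable (derive1n k u) t 1 &
      forall t, D t -> derive1n 3 u t = chazyIX_rhs delta (u t) (derive1n 1 u t)].

(* Here and below [s] stands for the square root of 5. [F] is instantiated
   with the complex numbers and with the rational functions of the jet. *)
Definition g1_den (F : fieldType) (s u u' u'' : F) : F :=
  6 * (- s - 1) * (3 * (- s - 1) * u * u' + u'').

Definition g1_formula (F : fieldType) (s delta u u' u'' : F) : F :=
  (- s - 3) *
  (108 * u ^+ 4 + 18 * (5 - s) * u ^+ 2 * u' + 6 * (3 - s) * u' ^+ 2
   + 3 * (- s - 1) * u * u'' + 2 * delta)
  / g1_den s u u' u''.

Definition g1_param (C : numFieldType) (s delta : C) : C :=
  (7 - 3 * s) / 2 * delta.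

Definition g1_den_fun (C : numFieldType) (s : C) (u : C -> C) : C -> C :=
  fun t => g1_den s (u t) (derive1n 1 u t) (derive1n 2 u t).

Definition g1_fun (C : numFieldType) (s delta : C) (u : C -> C) :
    C -> C :=
  fun t => g1_formula s delta (u t) (derive1n 1 u t) (derive1n 2 u t).

Definition poly3 (C : numFieldType) : idomainType := mpoly 3 C.

Definition ratfun3 (C : numFieldType) : fieldType := {fraction (poly3 C)}.

Definition pconst (C : numFieldType) (c : C) : poly3 C := mpolyC 3 c.

Definition pvar (C : numFieldType) (i : 'I_3) : poly3 C :=
  mpolyX C (mnm1 i).

Definition rconst (C : numFieldType) (c : C) : ratfun3 C :=
  FracField.tofrac (pconst c).

Definition rvar (C : numFieldType) (i : 'I_3) : ratfun3 C :=
  FracField.tofrac (pvar C i).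

Definition i0 : 'I_3 := @Ordinal 3 0 isT.
Definition i1 : 'I_3 := @Ordinal 3 1 isT.
Definition i2 : 'I_3 := @Ordinal 3 2 isT.

Definition rquot (C : numFieldType) (n d : poly3 C) : ratfun3 C :=
  FracField.tofrac n / FracField.tofrac d.

(* Total derivative along the solutions: the derivation with
   X_0' = X_1, X_1' = X_2, X_2' = 54 X_0^4 + 72 X_0^2 X_1 + 12 X_1^2 + delta. *)
Definition ptotal (C : numFieldType) (delta : C) (q : poly3 C) : poly3 C :=
  pvar C i1 * mderiv i0 q + pvar C i2 * mderiv i1 q
  + chazyIX_rhs (pconst delta) (pvar C i0) (pvar C i1) * mderiv i2 q.

(* Quotient rule on a representative; the result does not depend on it. *)
Definition rtotal (C : numFieldType) (delta : C) (f : ratfun3 C) : ratfun3 C :=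
  let r : {ratio (poly3 C)} := generic_quotient.repr f in
  rquot (ptotal delta \n_r * \d_r - \n_r * ptotal delta \d_r) (\d_r ^+ 2).

Definition g1_rat (C : numFieldType) (s delta : C) : ratfun3 C :=
  g1_formula (rconst s) (rconst delta) (rvar C i0) (rvar C i1) (rvar C i2).

(* The induced map (u, u', u'') |-> (p, p', p''). *)
Definition g1_jet (C : numFieldType) (s delta : C) (i : 'I_3) : ratfun3 C :=
  iter i (rtotal delta) (g1_rat s delta).

Definition psubst (C : numFieldType) (P : 'I_3 -> ratfun3 C) (q : poly3 C) :
    ratfun3 C :=
  mmap (@rconst C) P q.

(* The composite "Q after P" is defined, meaning that no denominator of Q
   vanishes identically on the image of P, and is equal to S. *)
Definition rcomp_eq (C : numFieldType) (Q P S : 'I_3 -> ratfun3 C) : Prop :=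
  forall i, exists n d : poly3 C,
    [/\ Q i = rquot n d, psubst P d != 0 & psubst P n / psubst P d = S i].

Definition birational (C : numFieldType) (P : 'I_3 -> ratfun3 C) : Prop :=
  exists Q : 'I_3 -> ratfun3 C,
    rcomp_eq Q P (@rvar C) /\ rcomp_eq P Q (@rvar C).

Definition jet (C : numFieldType) (u : C -> C) (t : C) (i : 'I_3) : C :=
  derive1n i u t.

(* At every t where the denominator is nonzero and a fraction n / d
   representing P_i is defined at the jet of u, the i-th derivative of the
   transform of u is the value of n / d there. *)
Definition g1_induces (C : numFieldType) (s delta : C)
    (P : 'I_3 -> ratfun3 C) : Prop :=
  forall (D : set C) (u : C -> C), chazyIX_solution delta D u ->
  forall t, D t -> g1_den_fun s u t != 0 ->
  forall (i : 'I_3) (n d : poly3 C),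
    P i = rquot n d -> meval (jet u t) d != 0 ->
    derive1n i (g1_fun s delta u) t = meval (jet u t) n / meval (jet u t) d.

(* The type annotation lets unification find the normed-module structure of
   [R[i]] over itself, so that [derivable] and [derive1n] on [Cx R -> Cx R]
   are complex differentiability and iterated complex derivatives. *)
Definition Cx (R : realType) : numFieldType := R[i].

Definition sqrt5 (R : realType) : Cx R := sqrtC (5 : R[i]).

(* Main.v *)
From HB Require Import structures.
Require Import Defs.
From mathcomp Require Import all_boot all_order all_algebra fraction complex.
From mathcomp Require Import classical_sets reals topology normedtype derive.
From mathcomp Require Import ring.
From mathcomp Require Import -(notations) mpoly.

Set Implicit Arguments.
Unset Strict Implicit.

Import Order.TTheory GRing.Theory Num.Theory.
Import numFieldNormedType.Exports.
Local Open Scope ring_scope.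
Local Open Scope classical_set_scope.

(** Let [a] be the golden ratio, [b = 1 - a = - 1 / a] its conjugate, and put
    [y = u' - 3 a u^2].  Chazy IX is a Riccati-like cascade in disguise: since
    [a^2 = a + 1], all terms in [u^4] and [u^2 y] cancel in [y''], and the
    equation becomes
      [y' = z],  [z' = K - 6 a u z]  with  [K = 6 y^2 / a^2 + delta]
    ([riccati'_ode]).  In these terms the unwieldy numerator and denominator of
    the transformation collapse to
      [p = a K / (3 z) - a^2 u]
    ([g1_formulaE]), and differentiating once gives
      [p' - 3 b p^2 = - b^4 y].
    So the transformation only rescales [y] and [z] by [- b^4] while it
    exchanges [a] with [b] ([riccati_image], [riccati'_image]).  Everything
    follows from this.

    Invariance: the conjugate variables [- b^4 y], [- b^4 z] of [p] satisfy the
    cascade for [b] and the parameter [b^4 delta], which is equivalent to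
    Chazy IX for [p]; and [b^4 = (7 - 3 sqrt 5) / 2].

    Birationality: from [(p, p', p'')] one recovers [y] and [z] by rescaling the
    conjugate variables, and then [u] from the formula for [p].  The resulting
    inverse is the same formula with [a] replaced by [b] and [delta] by
    [b^4 delta], because [a b = -1] ([image_jetK]).

    The closed formulas for [p], [p'], [p''] are used over two fields: complex
    numbers, where the derivatives are those of an actual solution, and rational
    functions of the jet, where the derivation is the total derivative.  The two
    are linked, and composites of rational maps are computed, by specializing
    rational functions along a ring morphism defined on polynomials. *)

(** * The jet of the transformed solution, as algebra over a field *)

Section StraightenedJet.
Variable F : fieldType.
Implicit Types a s d u v w y p : F.

Definition golden s : F := (1 + s) / 2.
Definition golden_conj a : F := 1 - a.

(** The variable [y] in which the equation straightens; [riccati'] is its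
    derivative along [(u, v, w)], and is the denominator of the transformation
    up to a nonzero constant. *)
Definition riccati a u v : F := v - 3 * a * u ^+ 2.
Definition riccati' a u v w : F := w - 6 * a * (u * v).
(** The coefficient [6 (2 - a)] is [6 / a^2] for the golden ratio. *)
Definition forcing a d y : F := 6 * (2 - a) * y ^+ 2 + d.

(** The three components of the jet of the transformed solution; the last two
    are the definitions of [riccati] and [riccati'] for the conjugate of [a],
    solved for the first and second derivative. *)
Definition image_u a d u v w : F :=
  a / 3 * (forcing a d (riccati a u v) / riccati' a u v w) - a ^+ 2 * u.
Definition image_u' a d u v w : F :=
  3 * golden_conj a * image_u a d u v w ^+ 2
  - golden_conj a ^+ 4 * riccati a u v.
Definition image_u'' a d u v w : F :=
  6 * golden_conj a * (image_u a d u v w * image_u' a d u v w)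
  - golden_conj a ^+ 4 * riccati' a u v w.

Definition image_jet (k : nat) a d u v w : F :=
  match k with
  | 0 => image_u a d u v w
  | 1 => image_u' a d u v w
  | _ => image_u'' a d u v w
  end.

Lemma golden_sqr s : 2 != 0 :> F -> s ^+ 2 = 5 -> golden s ^+ 2 = golden s + 1.
Proof. by move=> n2 hs; rewrite /golden; field: hs. Qed.

Lemma golden_conjE s : 2 != 0 :> F -> golden_conj (golden s) = golden (- s).
Proof. by move=> n2; rewrite /golden_conj /golden; field. Qed.

(** The left side is the derivative of [riccati'] along a solution.  This is
    where the golden ratio enters: the terms in [u^4] and in [u^2] times
    [riccati] have coefficients that vanish when [a^2 = a + 1]. *)
Lemma riccati'_ode a d u v w : a ^+ 2 = a + 1 ->
  chazyIX_rhs d u v - 6 * a * (v * v + u * w)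
  = forcing a d (riccati a u v) - 6 * a * u * riccati' a u v w.
Proof. by move=> ha; rewrite /chazyIX_rhs /forcing /riccati /riccati'; ring: ha. Qed.

(** The transformation acts on the straightened variables, read with the
    conjugate ratio on the target, as multiplication by a constant. *)
Lemma riccati_image a d u v w :
  riccati (golden_conj a) (image_u a d u v w) (image_u' a d u v w)
  = - golden_conj a ^+ 4 * riccati a u v.
Proof. by rewrite /image_u' {1}/riccati; ring. Qed.

Lemma riccati'_image a d u v w :
  riccati' (golden_conj a) (image_u a d u v w) (image_u' a d u v w)
    (image_u'' a d u v w)
  = - golden_conj a ^+ 4 * riccati' a u v w.
Proof. by rewrite /image_u'' {1}/riccati'; ring. Qed.

(** The left side is the quotient rule applied to [image_u], with [K] and [z]
    differentiated by the cascade.  The terms in [K^2 / z^2], [u K / z] and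
    [u^2] add up to [3 b p^2]; what remains is a multiple of [y]. *)
Lemma image_u_deriv a d u v w (y := riccati a u v) (z := riccati' a u v w) :
  3 != 0 :> F -> a ^+ 2 = a + 1 -> z != 0 ->
  a / 3 * (forcing a d y * (- z ^- 2 * (forcing a d y - 6 * a * u * z))
           + z^-1 * (12 * (2 - a) * y * z)) - a ^+ 2 * v
  = image_u' a d u v w.
Proof.
move=> n3 ha nz; rewrite /image_u' /image_u -/y -/z /golden_conj.
have -> : v = y + 3 * a * u ^+ 2 by rewrite /y /riccati; ring.
by rewrite /forcing; field: ha; rewrite nz.
Qed.

(** The left side is the third derivative of the transformed solution.  By
    [riccati'_ode] for the conjugate ratio, Chazy IX for [p] amounts to the
    cascade for the rescaled variables, where both sides are multiples of
    [K - 6 a u z]. *)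
Lemma image_u''_deriv a d u v w (z := riccati' a u v w)
    (p := image_u a d u v w) (q := image_u' a d u v w) (r := image_u'' a d u v w) :
  3 != 0 :> F -> a ^+ 2 = a + 1 -> z != 0 ->
  6 * golden_conj a * (q * q + p * r)
  - golden_conj a ^+ 4 * (forcing a d (riccati a u v) - 6 * a * u * z)
  = chazyIX_rhs (golden_conj a ^+ 4 * d) p q.
Proof.
move=> n3 ha nz.
have hb : golden_conj a ^+ 2 = golden_conj a + 1 by rewrite /golden_conj; ring: ha.
have := riccati'_ode (golden_conj a ^+ 4 * d) p q r hb.
rewrite riccati_image riccati'_image -/z => /(canRL (subrK _)) ->.
rewrite /p /image_u -/z /forcing /golden_conj.
by field: ha; rewrite nz.
Qed.

(** The rescaling factors for [a] and for [b] multiply to [(a b)^4 = 1], so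
    [y] and [z] return to themselves; then so does [u], being determined by
    [p], [y] and [z], and finally [v] and [w]. *)
Lemma image_jetK a d u v w (b := golden_conj a) (e := b ^+ 4 * d)
    (p := image_u a d u v w) (q := image_u' a d u v w) (r := image_u'' a d u v w) :
  3 != 0 :> F -> a ^+ 2 = a + 1 -> riccati' a u v w != 0 ->
  [/\ riccati' b p q r != 0, image_u b e p q r = u, image_u' b e p q r = v
    & image_u'' b e p q r = w].
Proof.
move=> n3 ha nz.
have hr : riccati b p q = - b ^+ 4 * riccati a u v by exact: riccati_image.
have hr' : riccati' b p q r = - b ^+ 4 * riccati' a u v w.
  exact: riccati'_image.
have hab : a * b = -1 by rewrite /b /golden_conj; ring: ha.
have nb : b != 0.
  by apply: contra_eq_neq hab => ->; rewrite mulr0 eq_sym oppr_eq0 oner_eq0.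
have nr : riccati' b p q r != 0 by rewrite hr' mulf_neq0 // oppr_eq0 expf_neq0.
have bK : golden_conj b = a by rewrite /b /golden_conj; ring.
have b4 : a ^+ 4 * b ^+ 4 = 1 by rewrite -exprMn hab; ring.
have hu : image_u b e p q r = u.
  rewrite /image_u hr hr' /e /p /image_u /forcing.
  set y := riccati a u v; set z := riccati' a u v w in nz *.
  by rewrite /b /golden_conj; field: ha; rewrite nz n3 oppr_eq0 expf_neq0.
have hv : image_u' b e p q r = v.
  by rewrite /image_u' hu bK hr /riccati; ring: b4.
by split=> //; rewrite /image_u'' hu hv bK hr' /riccati'; ring: b4.
Qed.

Lemma golden_neq0 a : a ^+ 2 = a + 1 -> a != 0.
Proof.
by apply: contra_eq_neq => ->; rewrite expr0n add0r eq_sym oner_neq0.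
Qed.

Lemma g1_denE s u v w : 2 != 0 :> F ->
  g1_den s u v w = - 12 * golden s * riccati' (golden s) u v w.
Proof. by move=> n2; rewrite /g1_den /riccati' /golden; field. Qed.

Lemma g1_den_neq0 s u v w : 2 != 0 :> F -> 3 != 0 :> F -> s ^+ 2 = 5 ->
  (g1_den s u v w != 0) = (riccati' (golden s) u v w != 0).
Proof.
move=> n2 n3 hs; rewrite g1_denE // mulf_eq0 mulf_eq0 oppr_eq0.
rewrite (negPf (golden_neq0 (golden_sqr n2 hs))) orbF.
have -> : 12 = 2 * 2 * 3 :> F by ring.
by rewrite !mulf_eq0 (negPf n2) (negPf n3).
Qed.

(** The numerator of [g1_formula] is, up to a constant,
    [2 (v - 3 a u^2)^2 / a + a delta / 3] minus a multiple of [u] times the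
    denominator. *)
Lemma g1_formulaE s d u v w : 2 != 0 :> F -> 3 != 0 :> F -> s ^+ 2 = 5 ->
  riccati' (golden s) u v w != 0 ->
  g1_formula s d u v w = image_u (golden s) d u v w.
Proof.
move=> n2 n3 hs nz; have ha := golden_sqr n2 hs; have na := golden_neq0 ha.
rewrite /g1_formula g1_denE // /image_u.
have es : s = 2 * golden s - 1 by rewrite /golden; field.
move: (golden s) es ha na nz => a -> ha na.
rewrite /forcing /riccati /riccati' => nz; field: ha.
have -> : -12 = - (2 * 2 * 3) :> F by ring.
by rewrite n3 nz na oppr_eq0 !mulf_neq0.
Qed.

End StraightenedJet.

Lemma g1_paramE (C : numFieldType) (s d : C) : s ^+ 2 = 5 ->
  g1_param s d = golden_conj (golden s) ^+ 4 * d.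
Proof.
have n2 : 2 != 0 :> C by rewrite pnatr_eq0.
by move=> hs; rewrite /g1_param golden_conjE // /golden; field: hs.
Qed.

(** * Total derivatives in a differential field *)

Section DifferentialField.
Variables (F : fieldType) (D : F -> F).
Hypothesis (derD : forall f g, D (f + g) = D f + D g).
Hypothesis (derM : forall f g, D (f * g) = D f * g + f * D g).

Let der0 : D 0 = 0.
Proof. by apply: (addrI (D 0)); rewrite -derD !addr0. Qed.

Let derN f : D (- f) = - D f.
Proof. by apply: (addrI (D f)); rewrite -derD !subrr der0. Qed.

Let der1 : D 1 = 0.
Proof. by apply: (addrI (D 1)); rewrite -[in RHS](mul1r 1) derM mul1r mulr1 addr0. Qed.

Let der_nat n : D n%:R = 0.
Proof. by elim: n => [|n IHn]; rewrite ?der0 // -natr1 derD IHn der1 addr0. Qed.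

Let derV f : f != 0 -> D f^-1 = - f ^- 2 * D f.
Proof.
move=> nf; apply: (mulfI nf).
have /eqP := derM f f^-1; rewrite divff // der1 eq_sym addrC addr_eq0 => /eqP ->.
by field.
Qed.

Variables (a d u v w : F).
Hypothesis (n3 : 3 != 0 :> F) (ha : a ^+ 2 = a + 1).
Hypothesis (nz : riccati' a u v w != 0).
Hypothesis (Da : D a = 0) (Dd : D d = 0).
Hypothesis (Du : D u = v) (Dv : D v = w) (Dw : D w = chazyIX_rhs d u v).

Let y := riccati a u v.
Let z := riccati' a u v w.

Let D_y : D y = z.
Proof.
rewrite /y /z /riccati /riccati' expr2 derD derN !derM der_nat Da Du Dv; ring.
Qed.

Let D_z : D z = forcing a d y - 6 * a * u * z.
Proof.
rewrite -riccati'_ode // /z /riccati' derD derN !derM der_nat Da Du Dv Dw; ring.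
Qed.

Let D_forcing : D (forcing a d y) = 12 * (2 - a) * y * z.
Proof.
rewrite /forcing expr2 derD !derM der_nat derD derN der_nat Da Dd D_y; ring.
Qed.

Lemma der_image_u : D (image_u a d u v w) = image_u' a d u v w.
Proof.
rewrite -image_u_deriv // /image_u expr2 derD derN !derM derV // derV //.
rewrite D_forcing D_z der_nat Da Du -/y -/z; ring.
Qed.

Lemma der_image_u' : D (image_u' a d u v w) = image_u'' a d u v w.
Proof.
have Db : D (golden_conj a) = 0 by rewrite /golden_conj derD derN der1 Da oppr0 addr0.
have Db4 : D (golden_conj a ^+ 4) = 0 by rewrite !exprS expr0 !derM Db der1; ring.
rewrite /image_u' /image_u'' -/y -/z; move: (golden_conj a ^+ 4) Db4 => c Dc.
rewrite expr2 derD derN !derM der_image_u D_y Db Dc der_nat; ring.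
Qed.
End DifferentialField.

(** * Derivatives along an actual solution *)

Section Derivatives.
Variable C : numFieldType.
Implicit Types (f g u : C -> C) (t df dg : C).

Lemma is_derive_add f g t df dg :
  is_derive t 1 f df -> is_derive t 1 g dg ->
  is_derive t 1 (fun x => f x + g x) (df + dg).
Proof. by move=> hf hg; apply: is_deriveD. Qed.

Lemma is_derive_mul f g t df dg :
  is_derive t 1 f df -> is_derive t 1 g dg ->
  is_derive t 1 (fun x => f x * g x) (f t * dg + g t * df).
Proof. by move=> hf hg; apply: is_deriveM. Qed.

Lemma is_derive_scale c f t df :
  is_derive t 1 f df -> is_derive t 1 (fun x => c * f x) (c * df).
Proof. by move=> hf; apply: is_deriveZ. Qed.

Lemma is_derive_sub f g t df dg :
  is_derive t 1 f df -> is_derive t 1 g dg ->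
  is_derive t 1 (fun x => f x - g x) (df - dg).
Proof. by move=> hf hg; apply: is_deriveB. Qed.

Lemma is_derive_inv f t df : f t != 0 ->
  is_derive t 1 f df -> is_derive t 1 (fun x => (f x)^-1) (- (f t) ^- 2 * df).
Proof.
move=> nf [hf <-]; apply: DeriveDef; first exact: derivableV.
by rewrite deriveV.
Qed.

(** An iterated derivative at a point depends on the lower ones in a
    neighbourhood, so a proposed list of successive derivatives can only be
    verified on an open set. *)
Lemma derive1n_chain (D : set C) (f : nat -> C -> C) g n :
  open D -> (forall t, D t -> g t = f 0%N t) ->
  (forall t, D t -> forall k, (k < n)%N -> is_derive t 1 (f k) (f k.+1 t)) ->
  (forall t, D t -> forall k, (k <= n)%N -> derive1n k g t = f k t) /\
  (forall t, D t -> forall k, (k < n)%N -> derivable (derive1n k g) t 1).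
Proof.
move=> oD g0 hf.
have near_f k t : D t -> (forall x, D x -> derive1n k g x = f k x) ->
    \near t, f k t = derive1n k g t.
  by move=> Dt e; apply: filterS (open_nbhs_nbhs (conj oD Dt)) => x /e.
have val t : D t -> forall k, (k <= n)%N -> derive1n k g t = f k t.
  move=> Dt k; elim: k t Dt => [|k IH] t Dt ltkn; first exact: g0.
  rewrite derive1nS derive1E.
  have nf := near_f k t Dt (fun x Dx => IH x Dx (ltnW ltkn)).
  by have [] := near_eq_is_derive nf (hf t Dt k ltkn).
split=> // t Dt k ltkn.
have nf := near_f k t Dt (fun x Dx => val x Dx k (ltnW ltkn)).
by have [] := near_eq_is_derive nf (hf t Dt k ltkn).
Qed.

Lemma is_derive_sqr f t df : is_derive t 1 f df ->
  is_derive t 1 (fun x => f x ^+ 2) (2 * (f t * df)).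
Proof.
by move=> hf; apply: is_derive_eq (is_derive_mul hf hf) _; rewrite mulr_natl.
Qed.
End Derivatives.

Section OnSolutions.
Variables (C : numFieldType) (s d : C) (D : set C) (u : C -> C).
Hypothesis (hs : s ^+ 2 = 5) (hu : chazyIX_solution d D u).

Let a := golden s.
Let v : C -> C := derive1n 1 u.
Let w : C -> C := derive1n 2 u.
Let n2 : 2 != 0 :> C. Proof. by rewrite pnatr_eq0. Qed.
Let n3 : 3 != 0 :> C. Proof. by rewrite pnatr_eq0. Qed.
Let ha : a ^+ 2 = a + 1. Proof. exact: golden_sqr. Qed.

Let der_jet k t : D t -> (k < 3)%N ->
  is_derive t 1 (derive1n k u) (derive1n k.+1 u t).
Proof.
case: hu => _ du _ Dt ltk3.
by rewrite derive1nS derive1E; apply: derivableP; apply: du.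
Qed.

Let y t := riccati a (u t) (v t).
Let z t := riccati' a (u t) (v t) (w t).
Let K t := forcing a d (y t).
Let p t := image_u a d (u t) (v t) (w t).
Let q t := image_u' a d (u t) (v t) (w t).
Let r t := image_u'' a d (u t) (v t) (w t).

Let der_u t : D t -> is_derive t 1 u (v t).
Proof. by move=> Dt; exact: (der_jet (k := 0) Dt isT). Qed.

Let der_v t : D t -> is_derive t 1 v (w t).
Proof. by move=> Dt; exact: (der_jet (k := 1) Dt isT). Qed.

Let der_w t : D t -> is_derive t 1 w (chazyIX_rhs d (u t) (v t)).
Proof.
move=> Dt; have [_ _ /(_ _ Dt) <-] := hu.
exact: (der_jet (k := 2) Dt isT).
Qed.

Let der_y t : D t -> is_derive t 1 y (z t).
Proof.
move=> Dt.
apply: is_derive_eq (is_derive_sub (der_v Dt)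
  (is_derive_scale (3 * a) (is_derive_sqr (der_u Dt)))) _.
rewrite /z /riccati'; ring.
Qed.

Let der_z t : D t -> is_derive t 1 z (K t - 6 * a * u t * z t).
Proof.
move=> Dt; rewrite -riccati'_ode //.
apply: is_derive_eq (is_derive_sub (der_w Dt)
  (is_derive_scale (6 * a) (is_derive_mul (der_u Dt) (der_v Dt)))) _.
ring.
Qed.

Let der_K t : D t -> is_derive t 1 K (12 * (2 - a) * y t * z t).
Proof.
move=> Dt.
apply: is_derive_eq (is_derive_add
  (is_derive_scale (6 * (2 - a)) (is_derive_sqr (der_y Dt)))
  (is_derive_cst d t 1)) _.
ring.
Qed.

Let der_p t : D t -> z t != 0 -> is_derive t 1 p (q t).
Proof.
move=> Dt nz; rewrite /q -image_u_deriv //.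
apply: is_derive_eq (is_derive_sub
  (is_derive_scale (a / 3)
     (is_derive_mul (der_K Dt) (is_derive_inv nz (der_z Dt))))
  (is_derive_scale (a ^+ 2) (der_u Dt))) _.
by [].
Qed.

Let der_q t : D t -> z t != 0 -> is_derive t 1 q (r t).
Proof.
move=> Dt nz.
apply: is_derive_eq (is_derive_sub
  (is_derive_scale (3 * golden_conj a) (is_derive_sqr (der_p Dt nz)))
  (is_derive_scale (golden_conj a ^+ 4) (der_y Dt))) _.
rewrite /r /image_u'' -/(p t) -/(q t) -/(z t); ring.
Qed.

Let der_r t : D t -> z t != 0 ->
  is_derive t 1 r (chazyIX_rhs (golden_conj a ^+ 4 * d) (p t) (q t)).
Proof.
move=> Dt nz.
have e := @image_u''_deriv _ a d (u t) (v t) (w t) n3 ha nz.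
apply: is_derive_eq (is_derive_sub
  (is_derive_scale (6 * golden_conj a)
     (is_derive_mul (der_p Dt nz) (der_q Dt nz)))
  (is_derive_scale (golden_conj a ^+ 4) (der_z Dt))) _.
apply: etrans e.
rewrite /= -/(p t) -/(q t) -/(r t) -/(z t) -/(y t) -/(K t).
ring.
Qed.

Let Omega := D `&` [set t | g1_den_fun s u t != 0].

Let open_Omega : open Omega.
Proof.
have [oD _ _] := hu; rewrite openE => t [Dt nz].
have nzt : z t != 0 by rewrite -(g1_den_neq0 (s := s)).
have cz : {for t, continuous z}.
  have [dz _] := der_z Dt.
  exact/differentiable_continuous/derivable1_diffP.
apply: filterI; first exact: (open_nbhs_nbhs (conj oD Dt)).
have nb : nbhs (z t) [set x : C | x != 0].
  exists `|z t|; first by rewrite /= normr_gt0.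
  move=> x; rewrite /= => lt; apply/eqP => x0; move: lt.
  by rewrite x0 subr0 ltxx.
have nt : nbhs t [set x : C | z x != 0] by exact: (cz _ nb).
by apply: filterS nt => x /=; rewrite /g1_den_fun g1_den_neq0.
Qed.

(** The index 3 closes the chain with the transformed equation itself. *)
Let image_fun k : C -> C :=
  match k with
  | 0 => p
  | 1 => q
  | 2 => r
  | _ => fun t => chazyIX_rhs (golden_conj a ^+ 4 * d) (p t) (q t)
  end.

Let image_chain :
  (forall t, Omega t -> forall k, (k <= 3)%N ->
     derive1n k (g1_fun s d u) t = image_fun k t) /\
  (forall t, Omega t -> forall k, (k < 3)%N ->
     derivable (derive1n k (g1_fun s d u)) t 1).
Proof.
apply: derive1n_chain => // t [Dt]; rewrite /= /g1_den_fun g1_den_neq0 // => nz.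
  by rewrite /g1_fun g1_formulaE.
move=> [|[|[|//]]] _; first exact: der_p.
- exact: der_q.
- exact: der_r.
Qed.

Lemma derive1n_g1_fun t k : Omega t -> (k < 3)%N ->
  derive1n k (g1_fun s d u) t =
  image_jet k a d (u t) (derive1n 1 u t) (derive1n 2 u t).
Proof.
move=> Ot ltk3; rewrite (image_chain.1 t Ot k (ltnW ltk3)).
by case: k ltk3 => [|[|[|//]]].
Qed.

Lemma g1_fun_solution : chazyIX_solution (g1_param s d) Omega (g1_fun s d u).
Proof.
split=> // [t Ot k ltk3|t Ot]; first exact: image_chain.2.
rewrite (image_chain.1 t Ot 3%N) // (image_chain.1 t Ot 1%N) //.
rewrite -[g1_fun s d u t]/(derive1n 0 (g1_fun s d u) t).
by rewrite (image_chain.1 t Ot 0%N) // g1_paramE.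
Qed.
End OnSolutions.

(** * The total derivative of rational functions of the jet *)

Section RationalFunctions.
Variable C : numFieldType.
Implicit Types (n d q : poly3 C) (f g : ratfun3 C).

(** The morphism instances below make constants and substitution available to
    the generic rewriting rules for ring morphisms. *)
Lemma pconst_is_zmod_morphism : zmod_morphism (@pconst C).
Proof. by move=> x y; apply: mpolyCB. Qed.
Lemma pconst_is_monoid_morphism : monoid_morphism (@pconst C).
Proof. by split=> [|x y]; [exact: mpolyC1|exact: mpolyCM]. Qed.
HB.instance Definition _ := GRing.isZmodMorphism.Build C (poly3 C) (@pconst C)
  pconst_is_zmod_morphism.
HB.instance Definition _ := GRing.isMonoidMorphism.Build C (poly3 C) (@pconst C)
  pconst_is_monoid_morphism.
HB.instance Definition _ := GRing.RMorphism.copy (@rconst C)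
  (@FracField.tofrac (poly3 C) \o @pconst C).

Lemma psubst_is_zmod_morphism P : zmod_morphism (@psubst C P).
Proof. exact: raddfB. Qed.
Lemma psubst_is_monoid_morphism P : monoid_morphism (@psubst C P).
Proof. by split=> [|x y]; [exact: rmorph1|exact: rmorphM]. Qed.
HB.instance Definition _ P :=
  GRing.isZmodMorphism.Build (poly3 C) (ratfun3 C) (@psubst C P)
  (psubst_is_zmod_morphism P).
HB.instance Definition _ P :=
  GRing.isMonoidMorphism.Build (poly3 C) (ratfun3 C) (@psubst C P)
  (psubst_is_monoid_morphism P).

Lemma psubstC P (c : C) : psubst P (pconst c) = rconst c.
Proof. exact: mmapC. Qed.
Lemma psubstX P i : psubst P (pvar C i) = P i.
Proof. by rewrite /psubst /pvar mmapX mmap1U. Qed.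

Lemma rquot_repr f :
  f = rquot \n_(generic_quotient.repr f) \d_(generic_quotient.repr f).
Proof.
set r := generic_quotient.repr f.
have rn0 : \d_r != 0 by exact: denom_ratioP.
rewrite -[LHS]generic_quotient.reprK -/r /rquot /FracField.tofrac; unlock.
rewrite -[_^-1]FracField.pi_inv -[RHS]FracField.pi_mul; congr (generic_quotient.pi _ _).
rewrite /FracField.mulf /FracField.invf.
by rewrite !numden_Ratio ?oner_eq0 // mulr1 mul1r Ratio_numden.
Qed.

Section TotalDerivative.
Variable delta : C.
Local Notation D := (ptotal delta).
Local Notation rt := (rtotal delta).

Lemma ptotalD p q : D (p + q) = D p + D q.
Proof. rewrite /ptotal !mderivD; ring. Qed.
Lemma ptotalM p q : D (p * q) = D p * q + p * D q.
Proof. rewrite /ptotal !mderivM; ring. Qed.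
Lemma ptotalC (c : C) : D (pconst c) = 0.
Proof. by rewrite /ptotal !mderivC; ring. Qed.
Lemma ptotal_var i : D (pvar C i) =
  nth 0 [:: pvar C i1; pvar C i2;
            chazyIX_rhs (pconst delta) (pvar C i0) (pvar C i1)] i.
Proof.
have dX j k : mderiv j (pvar C k) = (k == j)%:R.
  rewrite /pvar mderivX mnm1E; case: eqP => [->|_]; last by rewrite scale0r.
  by rewrite scale1r -{1}[mnm1 j]add0m addmK mpolyX0.
rewrite /ptotal !dX.
by case: i => [[|[|[|//]]] lt]; rewrite /eq_op /=; ring.
Qed.

(** The quotient rule gives the same fraction on every representative: with
    [n / d = m / e], cross-multiplying turns the difference of the two results
    into a combination of [n e - m d] and its total derivative. *)
Lemma rtotal_rquot n d : d != 0 ->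
  rt (rquot n d) = rquot (D n * d - n * D d) (d ^+ 2).
Proof.
move=> nd; rewrite /rtotal; set r := generic_quotient.repr _.
have := rquot_repr (rquot n d); rewrite -/r.
have := denom_ratioP r; move: \n_r \d_r => m e ne.
have inj x : (FracField.tofrac x == 0) = (x == 0) := tofrac_eq0 x.
move/eqP; rewrite /rquot eqr_div ?inj // -!rmorphM tofrac_eq => /eqP E.
apply/eqP; rewrite eqr_div ?inj ?expf_neq0 // -!rmorphM tofrac_eq; apply/eqP.
have := congr1 D E; rewrite !ptotalM => /eqP; rewrite -subr_eq0 => /eqP DE.
move/eqP: E; rewrite -subr_eq0 => /eqP E.
set h := D n * e + n * D e - (D m * d + m * D d) in DE.
have -> : (D m * e - m * D e) * d ^+ 2 = (D n * d - n * D d) * e ^+ 2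
  + (D e * d + D d * e) * (n * e - m * d) - e * d * h by rewrite /h; ring.
by rewrite E DE !mulr0 addr0 subr0.
Qed.

Lemma rquot_ind (P : ratfun3 C -> Prop) :
  (forall n d, d != 0 -> P (rquot n d)) -> forall f, P f.
Proof. by move=> h f; rewrite [f]rquot_repr; apply: h; apply: denom_ratioP. Qed.

Lemma rtotalD f g : rt (f + g) = rt f + rt g.
Proof.
elim/rquot_ind: f => m e ne; elim/rquot_ind: g => n d nd.
have inj x : (FracField.tofrac x == 0) = (x == 0) := tofrac_eq0 x.
have -> : rquot m e + rquot n d = rquot (m * d + n * e) (e * d).
  by rewrite /rquot rmorphD !rmorphM addf_div // inj.
rewrite !rtotal_rquot ?mulf_neq0 // ptotalD !ptotalM /rquot.
rewrite addf_div ?inj ?expf_neq0 // -!rmorphM -rmorphD.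
by congr (FracField.tofrac _ / FracField.tofrac _); ring.
Qed.

Lemma rtotalM f g : rt (f * g) = rt f * g + f * rt g.
Proof.
elim/rquot_ind: f => m e ne; elim/rquot_ind: g => n d nd.
have inj x : (FracField.tofrac x == 0) = (x == 0) := tofrac_eq0 x.
have mulq a b c h : rquot a b * rquot c h = rquot (a * c) (b * h) :> ratfun3 C.
  by rewrite /rquot !rmorphM mulf_div.
rewrite mulq !rtotal_rquot ?mulf_neq0 // !mulq !ptotalM /rquot.
rewrite addf_div ?inj ?mulf_neq0 ?expf_neq0 // -!rmorphM -rmorphD.
apply/eqP; rewrite eqr_div ?inj ?mulf_neq0 ?expf_neq0 // -!rmorphM.
by rewrite tofrac_eq; apply/eqP; ring.
Qed.

Lemma rtotal_poly q : rt (FracField.tofrac q) = FracField.tofrac (D q).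
Proof.
have -> : FracField.tofrac q = rquot q 1 by rewrite /rquot rmorph1 divr1.
have D1 : D 1 = 0 by rewrite -(rmorph1 (@pconst C)) ptotalC.
rewrite rtotal_rquot ?oner_neq0 // D1 mulr0 subr0 mulr1 expr1n.
by rewrite /rquot rmorph1 divr1.
Qed.

Lemma rtotal_const (c : C) : rt (rconst c) = 0.
Proof. by rewrite /rconst rtotal_poly ptotalC rmorph0. Qed.
End TotalDerivative.
End RationalFunctions.

(** * Specialization of rational functions *)

Section Specialization.
Variables (C : numFieldType) (L : fieldType) (phi : {rmorphism poly3 C -> L}).
Implicit Types (f g : ratfun3 C) (x y : L).

(** [phi] extends to the local ring of fractions with denominator outside its
    kernel, but not to the whole field.  The relation says that [f] lies in that
    local ring and that the extension maps it to [x].  For [phi] an evaluation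
    this is the value of [f] at a point; for [phi] a substitution it is the
    composite of rational maps. *)
Definition specializes f x := exists n d : poly3 C,
  [/\ f = rquot n d, phi d != 0 & phi n / phi d = x].

Lemma rquot_den_neq0 (d : poly3 C) :
  phi d != 0 -> (FracField.tofrac d : ratfun3 C) != 0.
Proof.
by move=> nd; rewrite tofrac_eq0; apply: contraNneq nd => ->; rewrite rmorph0.
Qed.

Lemma specializes_uniq f x n d :
  specializes f x -> f = rquot n d -> phi d != 0 -> phi n / phi d = x.
Proof.
move=> [m [e [-> ne <-]]] /eqP + nd.
rewrite /rquot eqr_div ?rquot_den_neq0 // -!rmorphM tofrac_eq => /eqP E.
by apply/eqP; rewrite eqr_div // -!rmorphM E.
Qed.

Lemma specializes_poly q : specializes (FracField.tofrac q) (phi q).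
Proof.
exists q, 1; split; last by rewrite rmorph1 divr1.
- by rewrite /rquot rmorph1 divr1.
- by rewrite rmorph1 oner_neq0.
Qed.

Lemma specializesD f g x y :
  specializes f x -> specializes g y -> specializes (f + g) (x + y).
Proof.
move=> [m [e [-> ne <-]]] [n [d [-> nd <-]]].
exists (m * d + n * e), (e * d); rewrite !rmorphM mulf_neq0 //; split=> //.
- by rewrite /rquot rmorphD !rmorphM addf_div // rquot_den_neq0.
- by rewrite rmorphD !rmorphM addf_div.
Qed.

Lemma specializesM f g x y :
  specializes f x -> specializes g y -> specializes (f * g) (x * y).
Proof.
move=> [m [e [-> ne <-]]] [n [d [-> nd <-]]].
exists (m * n), (e * d); rewrite !rmorphM mulf_neq0 //; split=> //.
- by rewrite /rquot !rmorphM mulf_div.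
- by rewrite mulf_div.
Qed.

Lemma specializesV f x :
  specializes f x -> x != 0 -> specializes f^-1 x^-1.
Proof.
move=> [m [e [-> ne <-]]]; rewrite mulf_eq0 negb_or => /andP[nm _].
by exists e, m; split; rewrite // /rquot invf_div.
Qed.

Lemma specializes_nat n : specializes n%:R n%:R.
Proof.
rewrite -(rmorph_nat (@FracField.tofrac (poly3 C))) -(rmorph_nat phi).
exact: specializes_poly.
Qed.

Lemma specializesN f x : specializes f x -> specializes (- f) (- x).
Proof.
move=> [m [e [-> ne <-]]]; exists (- m), e; split; rewrite // /rquot rmorphN.
- by rewrite mulNr.
- by rewrite mulNr.
Qed.

Lemma specializesX f x n : specializes f x -> specializes (f ^+ n) (x ^+ n).
Proof.
move=> fx; elim: n => [|n IHn]; first exact: (specializes_nat 1).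
by rewrite !exprS; apply: specializesM.
Qed.

(* Numerals and powers have to be recognized before sums and products, into
   which they would unfold. *)
Local Ltac specialize_all := repeat first
  [ assumption | apply: specializes_nat | apply: specializesN
  | apply: specializesX | apply: specializesD | apply: specializesM ].

Lemma specializes_neq0 f x : specializes f x -> x != 0 -> f != 0.
Proof.
move=> [n [d [-> nd <-]]]; rewrite mulf_eq0 negb_or => /andP[nn _].
by apply: mulf_neq0; rewrite ?invr_eq0; apply: rquot_den_neq0.
Qed.

Lemma specializes_riccati' a u v w a' u' v' w' :
  specializes a a' -> specializes u u' -> specializes v v' ->
  specializes w w' -> specializes (riccati' a u v w) (riccati' a' u' v' w').
Proof. by move=> sa su sv sw; specialize_all. Qed.

Lemma specializes_image_jet k a d u v w a' d' u' v' w' :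
  3 != 0 :> L -> riccati' a' u' v' w' != 0 ->
  specializes a a' -> specializes d d' ->
  specializes u u' -> specializes v v' -> specializes w w' ->
  specializes (image_jet k a d u v w) (image_jet k a' d' u' v' w').
Proof.
move=> n3 nz sa sd su sv sw.
have sric : specializes (riccati a u v) (riccati a' u' v') by specialize_all.
have sric' : specializes (riccati' a u v w) (riccati' a' u' v' w').
  exact: specializes_riccati'.
have siric' := specializesV sric' nz.
have si3 := specializesV (specializes_nat 3) n3.
have s1 := specializes_nat 1.
have sb : specializes (golden_conj a) (golden_conj a') by specialize_all.
have s0 : specializes (image_u a d u v w) (image_u a' d' u' v' w') by specialize_all.
have {}s1 : specializes (image_u' a d u v w) (image_u' a' d' u' v' w').
  by specialize_all.
by case: k => [|[|k]] //=; specialize_all.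
Qed.
End Specialization.

(** * The induced jet map and its inverse *)

Section JetMap.
Variables (C : numFieldType).
Implicit Types (a d s : C).

Let num_neq0 n : n.+1%:R != 0 :> C. Proof. by rewrite pnatr_eq0. Qed.
Let rat_neq0 n : n.+1%:R != 0 :> ratfun3 C.
Proof. by rewrite -(rmorph_nat (@rconst C)) fmorph_eq0. Qed.

Local Notation X i := (rvar C i).

Definition image_rat a d (i : 'I_3) : ratfun3 C :=
  image_jet i (rconst a) (rconst d) (X i0) (X i1) (X i2).

Lemma rconst_sqr a : a ^+ 2 = a + 1 -> rconst a ^+ 2 = rconst a + 1.
Proof. by move=> ha; rewrite -rmorphXn ha rmorphD rmorph1. Qed.

Lemma rconst_golden_conj a : rconst (golden_conj a) = golden_conj (rconst a).
Proof. by rewrite /golden_conj rmorphB rmorph1. Qed.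

(** The polynomial takes the value 1 at the jet [(0, 0, 1)]. *)
Lemma riccati'_rat_neq0 a : riccati' (rconst a) (X i0) (X i1) (X i2) != 0.
Proof.
pose P (i : 'I_3) : C := (i == i2)%:R.
have sX i : specializes (meval P) (X i) (P i).
  by rewrite -(mevalXU P i); exact: specializes_poly.
have sa : specializes (meval P) (rconst a) a.
  by rewrite -{2}[a](mevalC P); exact: specializes_poly.
apply: (specializes_neq0 (specializes_riccati' sa (sX i0) (sX i1) (sX i2))).
by rewrite /riccati' mul0r mulr0 subr0 oner_neq0.
Qed.

(** Iterating the total derivative by representatives yields the closed
    formulas of the differential field of rational functions of the jet. *)
Lemma g1_jetE s d i : s ^+ 2 = 5 -> g1_jet s d i = image_rat (golden s) d i.
Proof.
move=> hs; set a := golden s.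
have ha : rconst a ^+ 2 = rconst a + 1 by apply/rconst_sqr/golden_sqr.
have hrs : rconst s ^+ 2 = 5 by rewrite -rmorphXn hs rmorph_nat.
have ea : golden (rconst s) = rconst a.
  by rewrite /a /golden fmorph_div rmorphD rmorph1 rmorph_nat.
have nz := riccati'_rat_neq0 a.
have D0 : rtotal d (X i0) = X i1 by rewrite rtotal_poly ptotal_var.
have D1 : rtotal d (X i1) = X i2 by rewrite rtotal_poly ptotal_var.
have D2 : rtotal d (X i2) = chazyIX_rhs (rconst d) (X i0) (X i1).
  rewrite rtotal_poly ptotal_var /= /chazyIX_rhs.
  by rewrite !(rmorph_nat, rmorphXn, rmorphM, rmorphD).
have e0 : g1_rat s d = image_rat a d i0.
  have := @g1_formulaE _ (rconst s) (rconst d) (X i0) (X i1) (X i2)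
    (rat_neq0 1) (rat_neq0 2) hrs.
  by rewrite ea; apply.
have e1 : rtotal d (image_rat a d i0) = image_rat a d i1.
  exact: (der_image_u (rtotalD d) (rtotalM d) (rat_neq0 2) ha nz (rtotal_const d a)
            (rtotal_const d d) D0 D1 D2).
have e2 : rtotal d (image_rat a d i1) = image_rat a d i2.
  exact: (der_image_u' (rtotalD d) (rtotalM d) (rat_neq0 2) ha nz (rtotal_const d a)
            (rtotal_const d d) D0 D1 D2).
by rewrite /g1_jet; case: i => [[|[|[|//]]] lt] /=; rewrite e0 ?e1 ?e2.
Qed.

Lemma image_rat_specializes a d (P : 'I_3 -> ratfun3 C) i :
  riccati' (rconst a) (P i0) (P i1) (P i2) != 0 ->
  specializes (psubst P) (image_rat a d i)
    (image_jet i (rconst a) (rconst d) (P i0) (P i1) (P i2)).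
Proof.
move=> nz; apply: specializes_image_jet.
- exact: (rat_neq0 2).
- exact: nz.
- by rewrite -[Y in specializes _ _ Y](psubstC P); exact: specializes_poly.
- by rewrite -[Y in specializes _ _ Y](psubstC P); exact: specializes_poly.
- by rewrite -[Y in specializes _ _ Y](psubstX P); exact: specializes_poly.
- by rewrite -[Y in specializes _ _ Y](psubstX P); exact: specializes_poly.
- by rewrite -[Y in specializes _ _ Y](psubstX P); exact: specializes_poly.
Qed.

Lemma image_rat_comp_conj a d : a ^+ 2 = a + 1 ->
  rcomp_eq (image_rat (golden_conj a) (golden_conj a ^+ 4 * d))
    (image_rat a d) (@rvar C).
Proof.
move=> ha i; have n3 := rat_neq0 2.
have [nz k0 k1 k2] := image_jetK (rconst d) n3 (rconst_sqr ha) (riccati'_rat_neq0 a).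
have eb := rconst_golden_conj a.
have ee : rconst (golden_conj a ^+ 4 * d) = golden_conj (rconst a) ^+ 4 * rconst d.
  by rewrite -eb -rmorphXn -rmorphM.
have := @image_rat_specializes (golden_conj a) (golden_conj a ^+ 4 * d) (image_rat a d) i.
rewrite ee eb => /(_ nz) [n [e [-> ne val]]].
exists n, e; split; [by []|exact: ne|rewrite val].
case: i {val} => [[|[|[|//]]] lt] /=; [rewrite k0|rewrite k1|rewrite k2];
  by congr (rvar C _); apply: val_inj.
Qed.

(** Conjugation of [a] is an involution and [(a b)^4 = 1], so the inverse of
    the candidate inverse, given by the same rule, is the map itself. *)
Lemma image_rat_birational a d : a ^+ 2 = a + 1 -> birational (image_rat a d).
Proof.
move=> ha; exists (image_rat (golden_conj a) (golden_conj a ^+ 4 * d)).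
split; first exact: image_rat_comp_conj.
have hb : golden_conj a ^+ 2 = golden_conj a + 1 by rewrite /golden_conj; ring: ha.
have := image_rat_comp_conj (golden_conj a ^+ 4 * d) hb.
have -> : golden_conj (golden_conj a) = a by rewrite /golden_conj; ring.
have -> // : a ^+ 4 * (golden_conj a ^+ 4 * d) = d.
have ab : a * golden_conj a = -1 by rewrite /golden_conj; ring: ha.
by rewrite mulrA -exprMn ab; ring.
Qed.

(** A fraction has one value at a point where it is defined, whatever its
    representative; at a jet where the denominator of the transformation is
    nonzero the closed formulas provide that value. *)
Lemma g1_jet_induced s d : s ^+ 2 = 5 -> g1_induces s d (g1_jet s d).
Proof.
move=> hs D u hu t Dt nz i n e eP ne.
rewrite (@derive1n_g1_fun _ s d D u) //.
rewrite g1_jetE // in eP.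
have sX j : specializes (meval (jet u t)) (X j) (jet u t j).
  by rewrite -(mevalXU (jet u t) j); exact: specializes_poly.
apply/esym/(specializes_uniq _ eP ne).
apply: specializes_image_jet.
- exact: num_neq0.
- by rewrite -g1_den_neq0.
- by rewrite -{2}[golden s](mevalC (jet u t)); exact: specializes_poly.
- by rewrite -{2}[d](mevalC (jet u t)); exact: specializes_poly.
- exact: (sX i0).
- exact: (sX i1).
- exact: (sX i2).
Qed.
End JetMap.

Theorem theorem9p7 (R : realType) (delta : Cx R) :
  (forall (D : set (Cx R)) (u : Cx R -> Cx R),
     chazyIX_solution delta D u ->
     chazyIX_solution (g1_param (sqrt5 R) delta)
       (D `&` [set t | g1_den_fun (sqrt5 R) u t != 0])
       (g1_fun (sqrt5 R) delta u)) /\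
  g1_induces (sqrt5 R) delta (g1_jet (sqrt5 R) delta) /\
  birational (g1_jet (sqrt5 R) delta).
Proof.
have hs : sqrt5 R ^+ 2 = 5 by exact: sqrtCK.
split; first by move=> D u; apply: g1_fun_solution.
split; first exact: g1_jet_induced.
have -> : g1_jet (sqrt5 R) delta = image_rat (golden (sqrt5 R)) delta.
  by apply: boolp.funext => i; exact: g1_jetE.
by apply/image_rat_birational/golden_sqr; rewrite ?pnatr_eq0.
Qed.
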